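(* Assume $p>1$. The ratio between the size of the smallest matrix $M_t$ and the size of the classical Macaulay matrix $M_{t_n+1}$ satisfies $$\frac{\rho([t_n/2])}{\rho(t_n+1)}\le 2\,q^{\,n-1}.$$ In particular, this ratio tends to zero exponentially in $n$ when the number of variables $n$ tends to infinity and $p$ remains bigger than a constant $c>1$.
   Context: Let $n\ge1$ and $d_1,\dots,d_n\ge1$ be integers, $t_n:=\sum_{i=1}^n(d_i-1)$, $p:=\frac1n\sum_{i=1}^nd_i$ and $q:=\frac{p+1}{2p}$; $[x]$ denotes the integer part of $x$. For integers $t\ge0$ put $$\rho(t)=\binom{t+n-1}{n-1}+i(t_n-t),$$ where $i(u)$ is the dimension of the degree-$u$ part of the ideal generated by a regular sequence of $n$ homogeneous polynomials of degrees $d_1,\dots,d_n$ in a polynomial ring $k[X_1,\dots,X_n]$ over a field $k$ ($i(u)=0$ for $u<0$). The number $\rho(t)$ is the size of a certain square matrix $M_t$ attached to $n$ generic homogeneous polynomials of degrees $d_1,\dots,d_n$; the minimum of $\rho$ over integers $t\ge 0$ is attained at $t=[t_n/2]$, and $M_{t_n+1}$ is the classical Macaulay matrix. *)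

(* Defs.v *)
From HB Require Import structures.
From mathcomp Require Import all_boot all_order all_algebra.
From mathcomp Require Import boolp reals.
From mathcomp Require Import mpoly.

Set Implicit Arguments.
Unset Strict Implicit.
Unset Printing Implicit Defensive.

Import Order.TTheory GRing.Theory Num.Theory.

Local Open Scope ring_scope.

(* The polynomial ring is {mpoly k[n.+1]}: the (positive) number of variables,
   which is also the number of polynomials, is n.+1 throughout.  The library
   equips dhomog n.+1 k u, the space of homogeneous polynomials of degree u,
   with its vectType structure only in this form. *)

Section LinearSubspaces.
Variables (K : fieldType) (V : vectType K) (P : V -> Prop).
Hypothesis P0 : P 0.
Hypothesis PL : forall (a : K) (u v : V), P u -> P v -> P (a *: u + v).

Lemma linear_pred_vspace : exists W : {vspace V}, forall v, v \in W <-> P v.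
Proof.
have ext (W : {vspace V}) : (forall v, v \in W -> P v) ->
    (exists W' : {vspace V}, forall v, v \in W' <-> P v).
  have [m] := ubnP (\dim {:V} - \dim W)%N.
  elim: m W => // m IHm W ltm sWP.
  have [allW|/existsNP[v /not_implyP[Pv vW]]] := EM (forall v, P v -> v \in W).
    by exists W => v; split; [exact: sWP | exact: allW].
  have ltW : (\dim W < \dim (W + <[v]>))%N.
    rewrite (ltn_leqif (dimv_leqif_sup (addvSl _ _))) subv_add subvv.
    by rewrite -memvE; apply/negP.
  apply: (IHm (W + <[v]>)%VS).
    by apply: leq_trans (ltnSE ltm); apply: ltn_sub2l => //;
       apply: leq_trans ltW (dimvS (subvf _)).
  move=> w /memv_addP[w1 /sWP Pw1 [w2 /vlineP[a ->] ->]].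
  by rewrite addrC; apply: PL.
by apply: (ext 0%VS) => v; rewrite memv0 => /eqP->.
Qed.

End LinearSubspaces.

Section Ideals.
Variables (k : fieldType) (n : nat).
Implicit Types (f : 'I_n.+1 -> {mpoly k[n.+1]}) (p : {mpoly k[n.+1]}).

(* p belongs to the ideal generated by the f j with J j *)
Definition in_ideal f (J : pred 'I_n.+1) p : Prop :=
  exists g : 'I_n.+1 -> {mpoly k[n.+1]}, p = \sum_(j | J j) g j * f j.

Definition regular_sequence f : Prop :=
  (forall (i : 'I_n.+1) p,
      in_ideal f (fun j => (j < i)%N) (p * f i) ->
      in_ideal f (fun j => (j < i)%N) p)
  /\ ~ in_ideal f predT 1.

Lemma in_ideal0 f u : in_ideal f predT (0 : dhomog n.+1 k u).
Proof. by exists (fun=> 0); rewrite big1 // => j _; rewrite mul0r. Qed.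

Lemma in_idealL f u (a : k) (p1 p2 : dhomog n.+1 k u) :
  in_ideal f predT p1 -> in_ideal f predT p2 ->
  in_ideal f predT (a *: p1 + p2 : dhomog n.+1 k u).
Proof.
move=> [g1 E1] [g2 E2]; exists (fun j => a *: g1 j + g2 j).
rewrite linearP /= E1 E2 scaler_sumr -big_split /=.
by apply: eq_bigr => j _; rewrite mulrDl scalerAl.
Qed.

(* Degree-u part of the ideal generated by f, as a subspace of the space of
   homogeneous polynomials of degree u. *)
Definition ideal_part f (u : nat) : {vspace dhomog n.+1 k u} :=
  sval (cid (linear_pred_vspace (in_ideal0 f u) (@in_idealL f u))).

Lemma mem_ideal_part f u (p : dhomog n.+1 k u) :
  p \in ideal_part f u <-> in_ideal f predT p.
Proof. by rewrite /ideal_part; case: cid. Qed.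

Definition ideal_dim f (u : int) : nat :=
  match u with
  | Posz m => \dim (ideal_part f m)
  | Negz _ => 0
  end.

Definition homogeneous_regular f (d : 'I_n.+1 -> nat) : Prop :=
  (forall i, f i \is (d i).-homog) /\ regular_sequence f.

Definition tn (d : 'I_n.+1 -> nat) : nat := (\sum_(i < n.+1) (d i - 1))%N.

Definition rho f (d : 'I_n.+1 -> nat) (t : nat) : nat :=
  ('C(t + n.+1 - 1, n.+1 - 1) + ideal_dim f ((tn d)%:Z - t%:Z)%R)%N.

End Ideals.

Section Averages.
Variables (R : realType) (n : nat) (d : 'I_n.+1 -> nat).

Definition mean_degree : R := (\sum_(i < n.+1) d i)%N%:R / n.+1%:R.

Definition qratio : R := (mean_degree + 1) / (2 * mean_degree).

End Averages.

Arguments mean_degree R {n} d.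
Arguments qratio R {n} d.

Definition size_ratio (R : realType) (k : fieldType) (n : nat)
    (f : 'I_n.+1 -> {mpoly k[n.+1]}) (d : 'I_n.+1 -> nat) : R :=
  (rho f d (tn d %/ 2))%:R / (rho f d (tn d + 1))%:R.

Arguments size_ratio R {k n} f d.

(* Main.v *)
Require Import Defs.
From HB Require Import structures.
From mathcomp Require Import all_boot all_order all_algebra.
From mathcomp Require Import boolp reals.
From mathcomp Require Import mpoly.
From mathcomp Require Import zify ring lra.

Set Implicit Arguments.
Unset Strict Implicit.
Unset Printing Implicit Defensive.

Import Order.TTheory GRing.Theory Num.Theory.

Local Open Scope ring_scope.

(** The crude bound $i(u) \le \binom{u+n-1}{n-1}$, the dimension of the whole
space of forms of degree $u$ in $n$ variables, is already enough.  Put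
$T = t_n$; then $\rho([T/2])$ is at most the sum of the two binomials
$\binom{a+n-1}{n-1}$ with $a = [T/2]$ and $a = T - [T/2]$ (lemma
[rho_half_le]), while $\rho(T+1) \ge \binom{T+n}{n-1}$.  Each quotient is a
product of $n-1$ factors,
$$\binom{a+n-1}{n-1} \Big/ \binom{T+n}{n-1}
   = \prod_{j=1}^{n-1} \frac{a+j}{T+1+j},$$
which increase with $j$, so that it is enough to bound the last one by $q$
(lemma [bin_le_expr]).  As $p = (T+n)/n$, we have
$q = (T+2n)/(2(T+n))$, hence $q\,(T+n) = T/2 + n \ge a + n - 1$, because
$a \le (T+1)/2$.

For the exponential decay, $q = \frac12 + \frac1{2p}$ decreases with $p$, so
$p > c$ gives $q \le r := (c+1)/(2c) < 1$; the constant $A = 2/r$ absorbs the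
shift of the exponent from $n-1$ to $n$.

In the code, [n.+1] is the number of variables. *)

Lemma bin_le_expr (R : realFieldType) (x : R) (a b m : nat) :
  0 <= x <= 1 -> (a + m)%:R <= x * (b + m)%:R ->
  'C(a + m, m)%:R <= x ^+ m * 'C(b + m, m)%:R.
Proof.
move=> /andP[x0 x1]; elim: m => [|m IHm] hm; first by rewrite !bin0 expr0 mulr1.
(* As x <= 1, the hypothesis on the last factor passes to the earlier ones. *)
have {}IHm : 'C(a + m, m)%:R <= x ^+ m * 'C(b + m, m)%:R :> R.
  by apply: IHm; move: hm; rewrite !addnS -!natr1 mulrDr mulr1; lra.
have binS c : m.+1%:R * 'C(c + m.+1, m.+1)%:R
            = (c + m.+1)%:R * 'C(c + m, m)%:R :> R.
  by rewrite -!natrM -mul_bin_diag addnS.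
rewrite -(ler_pM2l (ltr0Sn R m)) binS mulrCA binS.
apply: le_trans (ler_pM (ler0n _ _) (ler0n _ _) hm IHm) _.
by rewrite exprS le_eqVlt; apply/orP; left; apply/eqP; ring.
Qed.

Lemma ideal_dim_le (k : fieldType) (n : nat)
    (f : 'I_n.+1 -> {mpoly k[n.+1]}) (u : nat) :
  (ideal_dim f u <= 'C(u + n, n))%N.
Proof.
rewrite /=; apply: leq_trans (dimvS (subvf _)) _.
by rewrite dimvf /dim /= -bin_sub ?leq_addr // addKn.
Qed.

Lemma rho_half_le (k : fieldType) (n : nat)
    (f : 'I_n.+1 -> {mpoly k[n.+1]}) (d : 'I_n.+1 -> nat) :
  (rho f d (tn d %/ 2)
     <= 'C(tn d %/ 2 + n, n) + 'C(tn d - tn d %/ 2 + n, n))%N.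
Proof.
rewrite /rho addnS !subn1 /= leq_add2l subzn ?leq_div //.
exact: ideal_dim_le.
Qed.

Lemma rho_Macaulay_ge (k : fieldType) (n : nat)
    (f : 'I_n.+1 -> {mpoly k[n.+1]}) (d : 'I_n.+1 -> nat) :
  ('C(tn d + 1 + n, n) <= rho f d (tn d + 1))%N.
Proof. by rewrite /rho (addnS _ n) !subn1 leq_addr. Qed.

Lemma mean_degreeE (R : realType) (n : nat) (d : 'I_n.+1 -> nat) :
  (forall i, (1 <= d i)%N) ->
  mean_degree R d = (tn d + n.+1)%:R / n.+1%:R.
Proof.
move=> d1; rewrite /mean_degree /tn; congr (_%:R / _).
rewrite -[X in (_ + X)%N]card_ord -sum1_card -big_split /=.
by apply: eq_bigr => i _; rewrite subnK.
Qed.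

Lemma qratio_tn (R : realType) (n : nat) (d : 'I_n.+1 -> nat) :
  (forall i, (1 <= d i)%N) ->
  qratio R d = ((tn d)%:R + 2 * n.+1%:R) / (2 * (tn d + n.+1)%:R).
Proof.
move=> d1; rewrite /qratio mean_degreeE // natrD.
have n0 : 0 < n.+1%:R :> R by rewrite ltr0Sn.
have t0 : 0 <= (tn d)%:R :> R by rewrite ler0n.
by field; rewrite ?pnatr_eq0 //=; apply/andP; split; lra.
Qed.

Lemma qratio_itv01 (R : realType) (n : nat) (d : 'I_n.+1 -> nat) :
  (forall i, (1 <= d i)%N) -> 0 <= qratio R d <= 1.
Proof.
move=> d1; rewrite qratio_tn // natrD.
have n0 : 0 < n.+1%:R :> R by rewrite ltr0Sn.
have t0 : 0 <= (tn d)%:R :> R by rewrite ler0n.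
have D0 : 0 < 2 * ((tn d)%:R + n.+1%:R) :> R by lra.
by rewrite ler_pdivlMr // ler_pdivrMr //; lra.
Qed.

(** The two values [T %/ 2] and [T - T %/ 2] both satisfy the hypothesis on
[a]. *)
Lemma bin_le_qratio (R : realType) (n : nat) (d : 'I_n.+1 -> nat) (a : nat) :
  (forall i, (1 <= d i)%N) -> (a.*2 <= (tn d).+1)%N ->
  'C(a + n, n)%:R <= qratio R d ^+ n * 'C(tn d + 1 + n, n)%:R.
Proof.
move=> d1 ha; apply: bin_le_expr; first exact: qratio_itv01.
have {}ha : 2 * a%:R <= (tn d)%:R + 1 :> R.
  by rewrite natr1 -natrM ler_nat mul2n.
rewrite qratio_tn // -addnA add1n.
have D0 : (tn d + n.+1)%:R != 0 :> R by rewrite addnS pnatr_eq0.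
by rewrite invfM mulrA mulfVK // natrD -[n.+1%:R]natr1; lra.
Qed.

Lemma size_ratio_le (R : realType) (k : fieldType) (n : nat)
    (f : 'I_n.+1 -> {mpoly k[n.+1]}) (d : 'I_n.+1 -> nat) :
  (forall i, (1 <= d i)%N) -> size_ratio R f d <= 2 * qratio R d ^+ n.
Proof.
move=> d1; have /andP[q0 _] := qratio_itv01 R d1.
have B0 : (0 < 'C(tn d + 1 + n, n))%N by rewrite bin_gt0 leq_addl.
have Bge := rho_Macaulay_ge f d.
rewrite /size_ratio ler_pdivrMr; last by rewrite ltr0n (leq_trans B0).
apply: (@le_trans _ _ (2 * qratio R d ^+ n * 'C(tn d + 1 + n, n)%:R)); last first.
  by rewrite ler_wpM2l ?ler_nat // mulr_ge0 ?exprn_ge0.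
apply: (@le_trans _ _ ('C(tn d %/ 2 + n, n)
                       + 'C(tn d - tn d %/ 2 + n, n))%:R).
  by rewrite ler_nat rho_half_le.
rewrite natrD -mulrA mulr_natl mulr2n.
by apply: lerD; apply: bin_le_qratio => //; lia.
Qed.

Lemma qratio_le (R : realType) (n : nat) (d : 'I_n.+1 -> nat) (c : R) :
  0 < c -> c <= mean_degree R d -> qratio R d <= (c + 1) / (2 * c).
Proof.
rewrite /qratio; move: (mean_degree R d) => p c0 cp.
have p0 := lt_le_trans c0 cp.
rewrite ler_pdivrMr ?mulr_gt0 // mulrAC ler_pdivlMr ?mulr_gt0 //.
by nra.
Qed.

Theorem proposition4p4 (R : realType) :
  (forall (n : nat) (d : 'I_n.+1 -> nat) (k : fieldType)
          (f : 'I_n.+1 -> {mpoly k[n.+1]}),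
      (forall i, (1 <= d i)%N) ->
      homogeneous_regular f d ->
      1 < mean_degree R d ->
      size_ratio R f d <= 2 * qratio R d ^+ (n.+1 - 1))
  /\
  (forall c : R, 1 < c ->
   exists A r : R, [/\ 0 < A, 0 < r, r < 1 &
     forall (n : nat) (d : 'I_n.+1 -> nat) (k : fieldType)
            (f : 'I_n.+1 -> {mpoly k[n.+1]}),
       (forall i, (1 <= d i)%N) ->
       homogeneous_regular f d ->
       c < mean_degree R d ->
       size_ratio R f d <= A * r ^+ n.+1]).
Proof.
split=> [n d k f d1 _ _|c c1]; first by rewrite subn1; exact: size_ratio_le.
have c0 : 0 < c by lra.
have r0 : 0 < (c + 1) / (2 * c) by rewrite divr_gt0 //; lra.
exists (2 / ((c + 1) / (2 * c))), ((c + 1) / (2 * c)); split=> //.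
- by rewrite divr_gt0.
- by rewrite ltr_pdivrMr; lra.
move=> n d k f d1 _ /ltW cp; have /andP[q0 _] := qratio_itv01 R d1.
apply: le_trans (size_ratio_le R f d1) _.
rewrite exprS mulrA divfK ?gt_eqF // ler_pM2l //.
by apply: lerXn2r; rewrite ?nnegrE ?(ltW r0) //; exact: qratio_le.
Qed.
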